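(* Let $(T_1,\dots,T_k)$ be a tuple of contractions on a Hilbert space $\mathcal{H}$ and $q_{ij}\in\mathbb{T}$ ($1\le i<j\le k$) such that $T_iT_j=q_{ij}T_jT_i$ and $T_iT_j^*=\overline{q_{ij}}\,T_j^*T_i$ for $1\le i<j\le k$. Then there exist a Hilbert space $\mathcal{K}\supseteq\mathcal{H}$ and unitaries $U_1,\dots,U_k$ on $\mathcal{K}$ with $U_iU_j=q_{ij}U_jU_i$ for $1\le i<j\le k$, such that \[ T_1(m_1)\cdots T_k(m_k)=P_{\mathcal{H}}U_1^{m_1}\cdots U_k^{m_k}|_{\mathcal{H}} \] for all $m_1,\dots,m_k\in\mathbb{Z}$.
   Context: For a contraction $C$ and $m\in\mathbb{Z}$: $C(m)=C^m$ if $m\ge1$, $C(0)=I$, and $C(m)=(C^* )^{|m|}$ if $m<0$. $P_{\mathcal{H}}$ denotes the orthogonal projection of $\mathcal{K}$ onto $\mathcal{H}$. *)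

(* Defs.v *)
From HB Require Import structures.
From mathcomp Require Import all_boot all_order all_algebra.
From mathcomp Require Import reals complex.
Set Implicit Arguments. Unset Strict Implicit. Unset Printing Implicit Defensive.
Import Order.TTheory GRing.Theory Num.Theory.
Local Open Scope ring_scope.

Record hilbert (R : realType) := Hilbert {
  hcar :> lmodType R[i];
  inner : hcar -> hcar -> R[i];
  inner_linl : forall (a : R[i]) (x y z : hcar),
      inner (a *: x + y) z = a * inner x z + inner y z;
  inner_conjsym : forall x y : hcar, inner y x = Num.conj (inner x y);
  inner_ge0 : forall x : hcar, 0 <= inner x x;
  inner_eq0 : forall x : hcar, inner x x = 0 -> x = 0;
  (* completeness w.r.t. the norm ||x|| = sqrt <x,x> (stated with squared norms) *)
  inner_complete : forall u : nat -> hcar,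
      (forall e : R, 0 < e -> exists N : nat, forall m n : nat, (N <= m)%N -> (N <= n)%N ->
           inner (u m - u n) (u m - u n) < (e%:C)%C) ->
      exists l : hcar, forall e : R, 0 < e -> exists N : nat, forall n : nat, (N <= n)%N ->
           inner (u n - l) (u n - l) < (e%:C)%C
}.

Section Ops.
Variable R : realType.

Definition h_linear (H K : hilbert R) (f : H -> K) :=
  forall (a : R[i]) (x y : H), f (a *: x + y) = a *: f x + f y.

Definition h_adjoint (H K : hilbert R) (f : H -> K) (fs : K -> H) :=
  forall (x : H) (y : K), inner (f x) y = inner x (fs y).

Definition h_contraction (H : hilbert R) (T : H -> H) :=
  h_linear T /\ forall x : H, inner (T x) (T x) <= inner x x.

Definition h_unitary (K : hilbert R) (U Us : K -> K) :=
  [/\ h_linear U, h_adjoint U Us, cancel U Us & cancel Us U].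

(* isometric embedding J : H -> K (identifying H with the closed subspace J H) *)
Definition h_isometry (H K : hilbert R) (J : H -> K) :=
  h_linear J /\ forall x y : H, inner (J x) (J y) = inner x y.
End Ops.

(* C(m) = C^m (m >= 0), (C^* )^|m| (m < 0), given C and its adjoint Cs *)
Definition zpow (T : Type) (C Cs : T -> T) (m : int) : T -> T :=
  match m with
  | Posz n => iter n C
  | Negz n => iter n.+1 Cs
  end.

Definition oprod (T : Type) (k : nat) (F : 'I_k -> T -> T) : T -> T :=
  foldr (fun i g => F i \o g) id (enum 'I_k).

(* Main.v *)
Require Import Defs.
From HB Require Import structures.
From mathcomp Require Import all_boot all_order all_algebra.
From mathcomp Require Import reals complex.
From mathcomp Require Import boolp classical_sets functions.
From mathcomp Require Import lra ring zify.
Import Order.TTheory GRing.Theory Num.Theory.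
Local Open Scope ring_scope.

(* The operators are made unitary one at a time, on spaces with a possibly
   degenerate inner product; a single completion at the end gives K.  To dilate
   the contraction T, take the finitely supported sequences f : Z -> V with the
   Toeplitz form <f,g> = sum_(m,n) s(T(n-m) f_m, g_n).  In the coordinates
   w_n = sum_(m <= n) T^(n-m) f_m, so that f_n = w_n - T w_(n-1), the form
   telescopes to sum_n (s(w_n, z_n) - s(T w_(n-1), T z_(n-1))), and positivity is
   visible because T is a contraction.  The shift is then a unitary dilation of T.
   Another operator S with T S = d S T acts by (w_n) |-> (d^n S w_n); this is
   again a contraction because S and its adjoint are adjoint for the defect form
   s(v, w) - s(T v, T w) too, where the powers of S^* S stay bounded, so that
   no square root of a defect operator is needed.  All commutation relations and
   the unitarity of the operators already treated survive the step. *)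

Set Implicit Arguments. Unset Strict Implicit. Unset Printing Implicit Defensive.

(** * Semi-inner products *)

Section SemiInner.
Variable R : realType.
Implicit Types (V W : lmodType R[i]).

Definition semi_inner V (s : V -> V -> R[i]) :=
  [/\ forall a x y z, s (a *: x + y) z = a * s x z + s y z,
      forall x y, s y x = Num.conj (s x y)
    & forall x, 0 <= s x x].

(** Squared norms are taken in R, so that estimates are real polynomial inequalities and no square
    root occurs. *)
Definition sqnorm V (s : V -> V -> R[i]) (x : V) : R := complex.Re (s x x).

Definition adjoint_pair V W (s : V -> V -> R[i]) (t : W -> W -> R[i])
    (f : V -> W) (g : W -> V) :=
  forall x y, t (f x) y = s x (g y).

Section Theory.
Variables (V : lmodType R[i]) (s : V -> V -> R[i]).
Hypothesis hs : semi_inner s.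
Local Notation N := (sqnorm s).

Lemma siP a x y z : s (a *: x + y) z = a * s x z + s y z.
Proof. by case: hs. Qed.

Lemma si_conj x y : s y x = Num.conj (s x y).
Proof. by case: hs. Qed.

Lemma siDl x y z : s (x + y) z = s x z + s y z.
Proof. by rewrite -[x]scale1r siP mul1r scale1r. Qed.

Lemma si0l z : s 0 z = 0.
Proof. by apply: (addrI (s 0 z)); rewrite -siDl !addr0. Qed.

Lemma siZl a x z : s (a *: x) z = a * s x z.
Proof. by rewrite -[a *: x]addr0 siP si0l addr0. Qed.

Lemma siNl x z : s (- x) z = - s x z.
Proof. by rewrite -scaleN1r siZl mulN1r. Qed.

Lemma siBl x y z : s (x - y) z = s x z - s y z.
Proof. by rewrite siDl siNl. Qed.

Lemma siDr x y z : s z (x + y) = s z x + s z y.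
Proof. by rewrite si_conj siDl rmorphD /= -!si_conj. Qed.

Lemma si0r z : s z 0 = 0.
Proof. by rewrite si_conj si0l rmorph0. Qed.

Lemma siZr a x z : s z (a *: x) = Num.conj a * s z x.
Proof. by rewrite si_conj siZl rmorphM /= -si_conj. Qed.

Lemma siNr x z : s z (- x) = - s z x.
Proof. by rewrite si_conj siNl rmorphN /= -si_conj. Qed.

Lemma siBr x y z : s z (x - y) = s z x - s z y.
Proof. by rewrite siDr siNr. Qed.

Definition siE := (siDl, siDr, siBl, siBr, siNl, siNr, siZl, siZr, si0l, si0r).

Lemma sqnormE x : s x x = (sqnorm s x)%:C%C.
Proof.
have [_ _ /(_ x)] := hs; rewrite /sqnorm.
by case: (s x x) => a b; rewrite lecE /= => /andP[/eqP -> _].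
Qed.

Lemma sqnorm_ge0 x : 0 <= N x.
Proof. by rewrite -ler0c -sqnormE; case: hs. Qed.

Lemma sqnormP t x y : N (x + t *: y)
  = N x + 2 * complex.Re (Num.conj t * s x y) + complex.Re (t * Num.conj t) * N y.
Proof.
rewrite {1}/sqnorm !siE (si_conj x y) [s x x]sqnormE [s y y]sqnormE.
case: (s x y) => c d; case: t => a b /=; ring.
Qed.

Lemma sqnorm_lt e x : (s x x < e%:C%C) = (N x < e).
Proof. by rewrite sqnormE ltcR. Qed.

Lemma sqnormN x : N (- x) = N x.
Proof. by rewrite /sqnorm !siE opprK. Qed.

Lemma sqnormB x y : N (x - y) = N (y - x).
Proof. by rewrite -sqnormN opprB. Qed.

Lemma sqnormD_le x y : N (x + y) <= 2 * N x + 2 * N y.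
Proof.
have := sqnorm_ge0 (x + (-1) *: y); have := sqnormP 1 x y.
rewrite scale1r => ->; rewrite sqnormP.
rewrite (rmorphN1 Num.conj) rmorph1 !mulN1r !mul1r raddfN /=. lra.
Qed.

Lemma sqmod_ge0 (z : R[i]) : 0 <= complex.Re (z * Num.conj z).
Proof. by case: z => a b /=; nra. Qed.

Lemma cauchy_schwarz x y :
  complex.Re (s x y * Num.conj (s x y)) <= N x * N y.
Proof.
set z := s x y; set p := complex.Re _.
(* The squared norm of x - r z y is nonnegative for every real r; r is then chosen. *)
have hq (r : R) : 0 <= N x - 2 * r * p + r ^+ 2 * p * N y.
  have := sqnorm_ge0 (x + (- r%:C%C * z) *: y).
  rewrite sqnormP -/z /p; case: (z) => a b /=; nra.
have p0 : 0 <= p by exact: sqmod_ge0.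
have [->|pN0] := eqVneq p 0; first by rewrite mulr_ge0 ?sqnorm_ge0.
have {p0 pN0}p0 : 0 < p by rewrite lt_def pN0.
have [Ny0|Ny] := eqVneq (N y) 0.
  (* For a null [y] the expression is affine in r, and this r makes it equal to -1. *)
  have := hq ((N x + 1) / (2 * p)); rewrite Ny0.
  have -> : 2 * ((N x + 1) / (2 * p)) * p = N x + 1 by field; lra.
  lra.
have {}Ny : 0 < N y by rewrite lt_def Ny sqnorm_ge0.
have := hq (N y)^-1.
have -> : N x - 2 * (N y)^-1 * p + (N y)^-1 ^+ 2 * p * N y = (N x * N y - p) / N y.
  by field; lra.
by rewrite pmulr_lge0 ?invr_gt0// subr_ge0.
Qed.

End Theory.

(** The complex numbers as a one-dimensional space with squared norm |z|^2, so that limits of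
    scalars are an instance of limits in a seminorm. *)
Definition mulconj (x y : R[i]^o) : R[i] := x * Num.conj y.

Lemma semi_inner_mulconj : semi_inner mulconj.
Proof.
split=> [a x y z|x y|x]; rewrite /mulconj.
- by rewrite mulrDl -mulrA.
- by rewrite rmorphM /= conjCK mulrC.
- by rewrite mul_conjC_ge0.
Qed.

(** * Adjoint pairs and contractions *)

Section Adjoints.
Variables (V : lmodType R[i]) (s : V -> V -> R[i]).
Hypothesis hs : semi_inner s.
Local Notation N := (sqnorm s).

Lemma adjoint_pairC S S' : adjoint_pair s s S S' -> adjoint_pair s s S' S.
Proof. by move=> h x y; rewrite (si_conj hs) -h -(si_conj hs). Qed.

(** By Cauchy-Schwarz, N(S' x)^2 = |<S S' x, x>|^2 is at most N(S S' x) N(x), hence at most N(S' x)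
    N(x). *)
Lemma adjoint_contraction S S' : adjoint_pair s s S S' ->
  (forall x, N (S x) <= N x) -> forall x, N (S' x) <= N x.
Proof.
move=> adj con x.
have := cauchy_schwarz hs (S (S' x)) x.
rewrite adj [X in X <= _ -> _](_ : _ = N (S' x) ^+ 2); last first.
  by rewrite (sqnormE hs) -[Num.conj _]/(conjc _) conjc_real -rmorphM.
have := con (S' x); have := sqnorm_ge0 hs (S' x); have := sqnorm_ge0 hs x.
nra.
Qed.

(** An excess delta = e_0 - a > 0 would propagate: if e_n - a >= delta, then e_n^2 >= a (e_n +
    delta), so e_(n+1) >= e_n + delta. Such linear growth contradicts the bound M. *)
Lemma log_convex_le (e : nat -> R) (a M : R) : 0 <= a ->
  (forall n, e n ^+ 2 <= a * e n.+1) -> (forall n, e n <= M) -> e 0%N <= a.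
Proof.
move=> a0 he hM; rewrite leNgt; apply/negP => lt_a.
have a1 : 0 < a.
  rewrite lt_def a0 andbT; apply/eqP => a_eq0.
  have := he 0%N; rewrite a_eq0 mul0r; nra.
have grow n : a + n.+1%:R * (e 0%N - a) <= e n.
  elim: n => [|n ih]; first by lra.
  have : a * (e n + (e 0%N - a)) <= a * e n.+1.
    apply: le_trans (he n).
    have : 0 <= n%:R * (e 0%N - a) by rewrite mulr_ge0// ?ler0n; lra.
    move: ih; rewrite -natr1 mulrDl mul1r; nra.
  rewrite ler_pM2l// => h; apply: le_trans h.
  by move: ih; rewrite -[n.+2%:R]natr1; lra.
have d0 : 0 < e 0%N - a by rewrite subr_gt0.
have := Num.Theory.archi_boundP (x := M / (e 0%N - a)).
have M0 : 0 <= M by have := hM 0%N; lra.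
move=> /(_ (divr_ge0 M0 (ltW d0))); rewrite ltr_pdivrMr//.
set n := Num.bound _ => ltn.
have := grow n; have := hM n; rewrite -natr1; lra.
Qed.

(* The trick of Krein and Lax: by Cauchy-Schwarz, e_n := <(S' S)^(2^n) x, x>
   satisfies e_n ^ 2 <= <x, x> e_(n+1), so a bounded e has e_0 <= <x, x>. *)
Lemma bounded_powers_contraction S S' x M : adjoint_pair s s S S' ->
  (forall n, N (iter n (S' \o S) x) <= M) -> N (S x) <= N x.
Proof.
move=> adj hM; pose C := S' \o S.
have hC n y z : s (iter n C y) z = s y (iter n C z).
  elim: n y z => // n ih y z; rewrite iterS iterSr -ih /C /=.
  by rewrite (adjoint_pairC adj) adj.
have sq n : complex.Re (s (iter (n + n) C x) x) = N (iter n C x).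
  by rewrite iterD hC.
pose e n := complex.Re (s (iter (2 ^ n) C x) x).
have e0 : e 0%N = N (S x) by rewrite /e /= (adjoint_pairC adj).
(* The hypothesis bounds only [e n.+1], the squared norm of [iter (2 ^ n) C x]; the maximum takes
   care of [e 0]. *)
rewrite -e0; apply: (@log_convex_le e _ (Num.max (e 0%N) M)).
- exact: sqnorm_ge0.
- move=> n; have := cauchy_schwarz hs (iter (2 ^ n) C x) x.
  rewrite /e expnS mul2n -addnn sq (mulrC (N x)); apply: le_trans.
  case: (s _ _) => a b /=; nra.
- case=> [|n]; first by rewrite le_max lexx.
  by rewrite /e expnS mul2n -addnn sq le_max hM orbT.
Qed.
End Adjoints.

End SemiInner.

(** * The shift dilation of a contraction *)

Section Orbits.
Variables (R : realType) (V : lmodType R[i]) (T : {linear V -> V}).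

(* In terms of the finitely supported sequence f_n := w_n - T w_(n-1), the
   orbit w is w_n = sum_(m <= n) T^(n-m) f_m. *)
Definition orbit_at (N : nat) (w : int -> V) :=
  (forall n : int, n < - N%:Z -> w n = 0) /\
  (forall n : int, N%:Z <= n -> w (n + 1) = T (w n)).

Definition eventual_orbit : {pred (int -> V)} :=
  fun w => `[< exists N, orbit_at N w >].

Lemma orbit_at_le M N w : (M <= N)%N -> orbit_at M w -> orbit_at N w.
Proof. by move=> MN [h1 h2]; split=> n hn; [apply: h1|apply: h2]; lia. Qed.

Lemma eventual_orbit_submod : submod_closed eventual_orbit.
Proof.
split=> [|a u v /asboolP[M hM] /asboolP[N hN]]; apply/asboolP.
  by exists 0%N; split=> n _ //=; rewrite linear0.
exists (maxn M N).
have [u0 uT] := orbit_at_le (leq_maxl M N) hM.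
have [v0 vT] := orbit_at_le (leq_maxr M N) hN.
split=> n hn; rewrite !fctE; first by rewrite u0// v0// scaler0 addr0.
by rewrite uT// vT// linearP.
Qed.
HB.instance Definition _ :=
  GRing.isSubmodClosed.Build _ _ eventual_orbit eventual_orbit_submod.

Record orbits := Orbits { orbit_fun :> int -> V; _ : orbit_fun \in eventual_orbit }.
HB.instance Definition _ := [isSub for orbit_fun].
HB.instance Definition _ := [Choice of orbits by <:].
HB.instance Definition _ := [SubChoice_isSubLmodule of orbits by <:].

Lemma orbitsP (w : orbits) : exists N, orbit_at N w.
Proof. by have /asboolP := valP w. Qed.

Lemma orbits_eq (w z : orbits) : (forall n, w n = z n) -> w = z.
Proof. by move=> h; apply: val_inj; apply/funext. Qed.

Lemma orbitsPE a (w z : orbits) n : (a *: w + z) n = a *: w n + z n.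
Proof. by []. Qed.
End Orbits.

(** * The Toeplitz form on orbits *)

Section OrbitForm.
Variables (R : realType) (V : lmodType R[i]) (s : V -> V -> R[i]).
Hypothesis hs : semi_inner s.
Variable T : {linear V -> V}.
Hypothesis contrT : forall x, sqnorm s (T x) <= sqnorm s x.
Implicit Types w z : orbits T.

(** The form of the defect operator I - T^* T. *)
Definition defect (v w : V) := s v w - s (T v) (T w).

Lemma semi_inner_defect : semi_inner defect.
Proof.
split=> [a x y z|x y|x]; rewrite /defect.
- by rewrite linearP !(siE hs); ring.
- by rewrite rmorphB /= -!(si_conj hs).
- by rewrite !(sqnormE hs) subr_ge0 lecR.
Qed.

(* The Toeplitz form of the two sequences f, telescoped; it does not depend on
   N once both arguments are orbits from rank N on. *)
Definition orbit_sum (N : nat) (w z : int -> V) : R[i] :=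
  s (w N%:Z) (z N%:Z)
  + \sum_(0 <= i < N + N) defect (w (i%:Z - N%:Z)) (z (i%:Z - N%:Z)).

(** Enlarging the window adds two defect terms. The one at -(N+1) vanishes with w; the one at N
    turns the new boundary term s(T w_N, T z_N) back into s(w_N, z_N). *)
Lemma orbit_sumS N (w z : int -> V) : orbit_at T N w -> orbit_at T N z ->
  orbit_sum N.+1 w z = orbit_sum N w z.
Proof.
move=> [w0 wT] [_ zT]; rewrite /orbit_sum addSn addnS.
rewrite big_nat_recl// [w (0%:Z - _)]w0; last by lia.
rewrite /defect linear0 !(si0l hs) subrr add0r big_nat_recr//=.
have -> : N.+1%:Z = N%:Z + 1 by lia.
have -> : (N + N).+1%:Z - (N%:Z + 1) = N%:Z by lia.
rewrite wT// zT//.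
rewrite addrCA [s (T _) _ + _]addrC subrK addrC; congr (_ + _).
by apply: eq_bigr => i _; have -> : i.+1%:Z - (N%:Z + 1) = i%:Z - N%:Z by lia.
Qed.

Lemma orbit_sum_eq M N (w z : int -> V) : (M <= N)%N ->
  orbit_at T M w -> orbit_at T M z -> orbit_sum N w z = orbit_sum M w z.
Proof.
move=> MN hw hz; rewrite -(subnKC MN); elim: (N - M)%N => [|n ih].
  by rewrite addn0.
by rewrite addnS orbit_sumS//; apply: orbit_at_le (leq_addr _ _) _.
Qed.

Definition orbit_rank w : nat := projT1 (cid (orbitsP w)).

Lemma orbit_rankP w : orbit_at T (orbit_rank w) w.
Proof. exact: projT2 (cid (orbitsP w)). Qed.

Definition orbit_form w z := orbit_sum (maxn (orbit_rank w) (orbit_rank z)) w z.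

Lemma orbit_formE N w z : orbit_at T N w -> orbit_at T N z ->
  orbit_form w z = orbit_sum N w z.
Proof.
move=> hw hz; set M := maxn (orbit_rank w) (orbit_rank z).
have hMw : orbit_at T M w := orbit_at_le (leq_maxl _ _) (orbit_rankP w).
have hMz : orbit_at T M z := orbit_at_le (leq_maxr _ _) (orbit_rankP z).
rewrite /orbit_form -/M -(orbit_sum_eq (leq_maxl M N) hMw hMz).
by rewrite (orbit_sum_eq (leq_maxr M N)).
Qed.

Lemma orbits_common2 w z : exists N, orbit_at T N w /\ orbit_at T N z.
Proof.
exists (maxn (orbit_rank w) (orbit_rank z)); split.
  exact: orbit_at_le (leq_maxl _ _) (orbit_rankP w).
exact: orbit_at_le (leq_maxr _ _) (orbit_rankP z).
Qed.

Lemma semi_inner_orbit_form : semi_inner orbit_form.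
Proof.
have hd := semi_inner_defect.
split=> [a x y z|x y|x].
- have [M [hx hy]] := orbits_common2 x y.
  have hz := orbit_rankP z; set P := maxn M (orbit_rank z).
  have {}hx := orbit_at_le (leq_maxl M (orbit_rank z)) hx.
  have {}hy := orbit_at_le (leq_maxl M (orbit_rank z)) hy.
  have {}hz := orbit_at_le (leq_maxr M (orbit_rank z)) hz.
  have hxy : orbit_at T P (a *: x + y : orbits T).
    split=> n hn; rewrite !orbitsPE.
      by rewrite hx.1// hy.1// scaler0 addr0.
    by rewrite hx.2// hy.2// linearP.
  rewrite !(orbit_formE (N := P))// /orbit_sum.
  under eq_bigr do rewrite (siP hd).
  by rewrite orbitsPE (siP hs) big_split /= -mulr_sumr; ring.
- have [N [hx hy]] := orbits_common2 x y.
  rewrite !(orbit_formE (N := N))// /orbit_sum rmorphD /= rmorph_sum /=.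
  rewrite -(si_conj hs); congr (_ + _).
  by apply: eq_bigr => i _; rewrite -(si_conj hd).
- rewrite (orbit_formE (orbit_rankP x) (orbit_rankP x)) addr_ge0//.
    by case: hs.
  by apply: sumr_ge0 => i _; case: hd.
Qed.
End OrbitForm.

(** * Shift, embedding and twisted operators on orbits *)

Section OrbitMaps.
Variables (R : realType) (V : lmodType R[i]) (T : {linear V -> V}).
Implicit Types w z : orbits T.

Definition orbits_of (w : int -> V) (h : exists N, orbit_at T N w) : orbits T :=
  Orbits (asboolT h : w \in eventual_orbit T).

Lemma shift_orbit_at N (w : int -> V) (k : int) : `|k| <= 1 ->
  orbit_at T N w -> orbit_at T N.+1 (fun n => w (n + k)).
Proof.
move=> k1 [h1 h2]; split=> n hn; first by apply: h1; lia.
by rewrite -h2; [congr w; lia|lia].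
Qed.

Lemma forward_subproof w : exists N, orbit_at T N (fun n => w (n + 1)).
Proof. by have [N hN] := orbitsP w; exists N.+1; apply: shift_orbit_at. Qed.

Lemma backward_subproof w : exists N, orbit_at T N (fun n => w (n - 1)).
Proof. by have [N hN] := orbitsP w; exists N.+1; apply: shift_orbit_at. Qed.

(** The unitary that dilates T; [backward] is its inverse and its adjoint. *)
Definition forward w := orbits_of (forward_subproof w).
Definition backward w := orbits_of (backward_subproof w).

Lemma forward_is_linear : linear forward.
Proof. by move=> a x y; apply: orbits_eq. Qed.
HB.instance Definition _ :=
  GRing.isLinear.Build _ (orbits T) (orbits T) _ forward forward_is_linear.

Lemma backward_is_linear : linear backward.
Proof. by move=> a x y; apply: orbits_eq. Qed.
HB.instance Definition _ :=
  GRing.isLinear.Build _ (orbits T) (orbits T) _ backward backward_is_linear.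

Lemma forwardK : cancel forward backward.
Proof. by move=> w; apply: orbits_eq => n /=; congr (w _); lia. Qed.

Lemma backwardK : cancel backward forward.
Proof. by move=> w; apply: orbits_eq => n /=; congr (w _); lia. Qed.

(** The orbit of the sequence f with f_0 = x and f_n = 0 elsewhere; it embeds V. *)
Definition start (x : V) (n : int) : V := if n is Posz m then iter m T x else 0.

Lemma start_orbit_at x : orbit_at T 0 (start x).
Proof. by split=> -[n|n] //= _; rewrite addn1. Qed.

Definition orbit_of (x : V) : orbits T :=
  orbits_of (ex_intro _ 0%N (start_orbit_at x)).

Lemma iter_linear n : linear (iter n T).
Proof. by elim: n => [|n ih] a x y //=; rewrite ih linearP. Qed.

Lemma orbit_of_linear a x y :
  orbit_of (a *: x + y) = a *: orbit_of x + orbit_of y.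
Proof.
apply: orbits_eq => -[n|n]; rewrite orbitsPE /=; first exact: iter_linear.
by rewrite scaler0 addr0.
Qed.

Section Twist.
Variables (S : {linear V -> V}) (d : R[i]).
Hypothesis d0 : d != 0.
Hypothesis TS : forall x, T (S x) = d *: S (T x).

(** T S = d S T costs one factor d for each application of T, and this is the growth of the weight
    d^n. *)
Lemma twist_orbit_at N (w : int -> V) : orbit_at T N w ->
  orbit_at T N (fun n => d ^ n *: S (w n)).
Proof.
move=> [h1 h2]; split=> n hn; first by rewrite h1// linear0 scaler0.
by rewrite h2// linearZ /= TS scalerA expfzDr.
Qed.

Lemma twist_subproof w : exists N, orbit_at T N (fun n => d ^ n *: S (w n)).
Proof. by have [N hN] := orbitsP w; exists N; apply: twist_orbit_at. Qed.

Definition twist w := orbits_of (twist_subproof w).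

Lemma twistE w n : twist w n = d ^ n *: S (w n).
Proof. by []. Qed.

Lemma twist_is_linear : linear twist.
Proof.
move=> a x y; apply: orbits_eq => n; rewrite orbitsPE !twistE orbitsPE.
by rewrite linearP scalerDr !scalerA mulrC.
Qed.
HB.instance Definition _ :=
  GRing.isLinear.Build _ (orbits T) (orbits T) _ twist twist_is_linear.

(** Shifting the weights d^n by one index produces the scalar d, so the shift and the twist satisfy
    the relation of T and S. *)
Lemma forward_twist w : forward (twist w) = d *: twist (forward w).
Proof.
apply: orbits_eq => n; rewrite -[d *: _]addr0 orbitsPE /= addr0.
by rewrite scalerA expfzDr// mulrC.
Qed.

Lemma twist_orbit_of x : twist (orbit_of x) = orbit_of (S x).
Proof.
apply: orbits_eq => -[n|n]; rewrite twistE /=; last by rewrite linear0 scaler0.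
elim: n => [|n ih]; first by rewrite scale1r.
by rewrite !iterS -ih linearZ /= TS scalerA exprSzr.
Qed.
End Twist.

Lemma twist_commute (S1 S2 : {linear V -> V}) (d1 d2 : R[i])
    (d1N0 : d1 != 0) (d2N0 : d2 != 0)
    (TS1 : forall x, T (S1 x) = d1 *: S1 (T x))
    (TS2 : forall x, T (S2 x) = d2 *: S2 (T x)) c w :
  (forall x, S1 (S2 x) = c *: S2 (S1 x)) ->
  twist d1N0 TS1 (twist d2N0 TS2 w) = c *: twist d2N0 TS2 (twist d1N0 TS1 w).
Proof.
move=> S12; apply: orbits_eq => n; rewrite -[c *: _]addr0 orbitsPE addr0.
rewrite !twistE !linearZ /= S12 !scalerA; congr (_ *: _); ring.
Qed.

(** The weights cancel along with the operators; invertibility obtained at earlier stages survives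
    in this way. *)
Lemma twist_cancel (S1 S2 : {linear V -> V}) (d1 d2 : R[i])
    (d1N0 : d1 != 0) (d2N0 : d2 != 0)
    (TS1 : forall x, T (S1 x) = d1 *: S1 (T x))
    (TS2 : forall x, T (S2 x) = d2 *: S2 (T x)) :
  d1 * d2 = 1 -> cancel S1 S2 -> cancel (twist d1N0 TS1) (twist d2N0 TS2).
Proof.
move=> d12 SK w; apply: orbits_eq => n; rewrite !twistE linearZ /= SK scalerA.
by rewrite -expfzMl mulrC d12 exp1rz scale1r.
Qed.
End OrbitMaps.

(** * Adjoints, contractivity and power dilation for the Toeplitz form *)

Section OrbitFormMaps.
Variables (R : realType) (V : lmodType R[i]) (s : V -> V -> R[i]).
Hypothesis hs : semi_inner s.
Variables (T T' : {linear V -> V}).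
Hypothesis TT' : adjoint_pair s s T T'.
Hypothesis contrT : forall x, sqnorm s (T x) <= sqnorm s x.
Implicit Types w z : orbits T.
Local Notation os := (orbit_form s (T := T)).

Let hd := semi_inner_defect hs contrT.
Let hos := semi_inner_orbit_form hs contrT.

(** The two defect sums agree after a shift of the index, except at the ends: w vanishes at -(N+1),
    and at the upper end the extra defect term telescopes with the boundary term. *)
Lemma forward_backward_adjoint : adjoint_pair os os (@forward _ _ T) (@backward _ _ T).
Proof.
move=> w z; have [N [hw hz]] := orbits_common2 w z.
rewrite (orbit_formE hs (N := N.+1)); last 2 first.
- exact: shift_orbit_at hw.
- exact: orbit_at_le (leqnSn N) hz.
rewrite (orbit_formE hs (N := N.+1)); last 2 first.
- exact: orbit_at_le (leqnSn N) hw.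
- exact: shift_orbit_at hz.
rewrite /orbit_sum addSn big_nat_recr//= big_nat_recl//=.
rewrite [w (0%:Z - _)]hw.1; last by lia.
rewrite (si0l hd) add0r.
have -> : (N + N.+1)%:Z - N.+1%:Z + 1 = N.+1%:Z by lia.
have -> : (N + N.+1)%:Z - N.+1%:Z = N.+1%:Z - 1 by lia.
rewrite hw.2; last by lia.
have -> : z N.+1 = T (z (N.+1%:Z - 1)).
  by rewrite -hz.2; [congr (z _); lia|lia].
rewrite /defect addrCA [s (T _) _ + _]addrC subrK addrC; congr (_ + _).
apply: eq_bigr => i _; congr (s (w _) (z _) - s (T (w _)) (T (z _))); lia.
Qed.

(** In the term with T the relations produce d on one side and the conjugate of d' on the other, and
    these are equal. *)
Lemma defect_adjoint (S S' : {linear V -> V}) (d d' : R[i]) :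
  adjoint_pair s s S S' -> Num.conj d = d' ->
  (forall x, T (S x) = d *: S (T x)) -> (forall x, T (S' x) = d' *: S' (T x)) ->
  adjoint_pair (defect s T) (defect s T) S S'.
Proof.
move=> SS' dd' TS TS' x y.
by rewrite /defect TS TS' !(siE hs) SS' SS' -dd' conjCK.
Qed.

Section TwistForm.
Variables (S S' : {linear V -> V}) (d d' : R[i]).
Hypotheses (d0 : d != 0) (d'0 : d' != 0).
Hypothesis TS : forall x, T (S x) = d *: S (T x).
Hypothesis TS' : forall x, T (S' x) = d' *: S' (T x).
Hypothesis SS' : adjoint_pair s s S S'.
Hypothesis dd' : Num.conj d = d'.

Lemma twist_adjoint : adjoint_pair os os (twist d0 TS) (twist d'0 TS').
Proof.
move=> w z; have [N [hw hz]] := orbits_common2 w z.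
rewrite !(orbit_formE hs (N := N))//; try exact: twist_orbit_at.
have conjX n : Num.conj (d' ^ n) = d ^ n by rewrite -dd' fmorphXz /= conjCK.
rewrite /orbit_sum !twistE !(siE hs) SS' conjX; congr (_ + _).
apply: eq_bigr => i _; rewrite !twistE (siZl hd) (siZr hd) conjX.
by rewrite (defect_adjoint SS' dd' TS TS').
Qed.

(** The weights are unimodular and drop out of every term, so it suffices that S contracts both [s]
    and the defect form. *)
Lemma twist_contraction : (forall x, sqnorm s (S x) <= sqnorm s x) ->
  (d * d' = 1) -> forall w, sqnorm os (twist d0 TS w) <= sqnorm os w.
Proof.
move=> contrS d1 w.
have contrS' := adjoint_contraction hs SS' contrS.
have dS x : sqnorm (defect s T) (S x) <= sqnorm (defect s T) x.
  apply: (bounded_powers_contraction hd (defect_adjoint SS' dd' TS TS')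
    (M := sqnorm s x)) => n.
  (* The defect form is dominated by [s], which S and S' contract; this bounds the powers of S'
     S. *)
  have : sqnorm (defect s T) (iter n (S' \o S) x) <= sqnorm s (iter n (S' \o S) x).
    rewrite /sqnorm /defect raddfB /= gerBl; exact: sqnorm_ge0.
  move=> /le_trans; apply; elim: n => //= n; apply: le_trans.
  exact: le_trans (contrS' _) (contrS _).
have modd n : d ^ n * Num.conj (d ^ n) = 1.
  by rewrite fmorphXz /= dd' -expfzMl d1 exp1rz.
have [N hN] := orbitsP w.
have tN : orbit_at T N (twist d0 TS w) by apply: twist_orbit_at.
rewrite -lecR -!(sqnormE hos) !(orbit_formE hs (N := N))// /orbit_sum.
apply: lerD; first by rewrite twistE !(siE hs) mulrA modd mul1r !(sqnormE hs) lecR.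
apply: ler_sum => i _; rewrite twistE (siZl hd) (siZr hd) mulrA modd mul1r.
by rewrite !(sqnormE hd) lecR.
Qed.
End TwistForm.

Lemma orbit_of_isometry x y : os (orbit_of T x) (orbit_of T y) = s x y.
Proof.
rewrite (orbit_formE hs (N := 0)); try exact: start_orbit_at.
by rewrite /orbit_sum big_nil addr0.
Qed.

(** The projection of w onto the embedded V, found without completeness: the form against an
    embedded x is a finite sum of terms in T^n x, and every T moves to the left argument as T'. *)
Lemma orbit_of_coadjoint w : exists p, forall x, os w (orbit_of T x) = s p x.
Proof.
pose repr (g : V -> R[i]) := exists p, forall x, g x = s p x.
have reprD g h : repr g -> repr h -> repr (fun x => g x + h x).
  by move=> [p hp] [r hr]; exists (p + r) => x; rewrite (siE hs) hp hr.
have reprN g : repr g -> repr (fun x => - g x).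
  by move=> [p hp]; exists (- p) => x; rewrite (siE hs) hp.
have repr0 : repr (fun=> 0) by exists 0 => x; rewrite (siE hs).
have repr_sum n (g : nat -> V -> R[i]) : (forall i, repr (g i)) ->
    repr (fun x => \sum_(0 <= i < n) g i x).
  move=> hg; elim: n => [|n ih].
    by have [p hp] := repr0; exists p => x; rewrite big_nil -hp.
  have [p hp] := reprD _ _ ih (hg n).
  by exists p => x; rewrite big_nat_recr //= -hp.
have reprT n v : repr (fun x => s v (iter n T x)).
  elim: n v => [|n ih] v; first by exists v.
  have [p hp] := ih (T' v); exists p => x.
  by rewrite -hp iterS (adjoint_pairC hs TT').
have repr_start n v : repr (fun x => s v (start T x n)).
  by case: n => n //=; exists 0 => x; rewrite (si0r hs) (si0l hs).
have [N hN] := orbitsP w.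
have [p hp] : repr (fun x => orbit_sum s T N w (start T x)).
  apply: (reprD) => //; apply: repr_sum => i; apply: reprD => //; apply: reprN.
  have [p hp] := repr_start (i%:Z - N%:Z) (T' (T (w (i%:Z - N%:Z)))).
  by exists p => x; rewrite -hp (adjoint_pairC hs TT').
exists p => x; rewrite -hp (orbit_formE hs (N := N))//.
exact: orbit_at_le (leq0n N) (start_orbit_at T x).
Qed.

(** An embedded y vanishes at negative indices, so only the part of w from 0 on counts; that part
    has rank 0, where the defect sum is empty. *)
Lemma orbit_form_start w y : orbit_at T 0 (fun n => if 0 <= n then w n else 0) ->
  os w (orbit_of T y) = s (w 0) y.
Proof.
move=> h0; pose w0 : orbits T := orbits_of (ex_intro _ 0%N h0).
rewrite -[RHS](_ : os w0 (orbit_of T y) = _); last first.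
  rewrite (orbit_formE hs (N := 0))//; try exact: start_orbit_at.
  by rewrite /orbit_sum big_nil addr0.
have hy N := orbit_at_le (leq0n N) (start_orbit_at T y).
have [N hN] := orbitsP w.
have hN0 := orbit_at_le (leq0n N) h0.
rewrite !(orbit_formE hs (N := N))// /orbit_sum; congr (_ + _).
apply: eq_bigr => i _ /=; case: (i%:Z - N%:Z) => n //=.
by rewrite !(si0r hd).
Qed.

Lemma power_dilation (m : int) x y :
  os (zpow (@forward _ _ T) (@backward _ _ T) m (orbit_of T x)) (orbit_of T y)
  = s (zpow T T' m x) y.
Proof.
(* Nonnegative powers: after n shifts the orbit of v has the value T^n v at index 0 and is an orbit
   from there on. *)
have fwd n v u : os (iter n (@forward _ _ T) (orbit_of T v)) (orbit_of T u)
    = s (iter n T v) u.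
  have fE k : iter n (@forward _ _ T) (orbit_of T v) k = start T v (k + n%:Z).
    elim: n k => [|n ih] k; first by rewrite addr0.
    by rewrite iterS /= ih; congr start; lia.
  rewrite orbit_form_start ?fE//; split=> -[k|k]//= _.
  by rewrite !fE /= -iterS; congr iter; lia.
have adj n : adjoint_pair os os (iter n (@backward _ _ T)) (iter n (@forward _ _ T)).
  elim: n => // n ih a b; rewrite iterS iterSr -ih.
  exact: (adjoint_pairC hos forward_backward_adjoint).
have adjT n : adjoint_pair s s (iter n T') (iter n T).
  by elim: n => // n ih a b; rewrite iterS iterSr -ih (adjoint_pairC hs TT').
case: m => n; first exact: fwd.
(* Negative powers: passing to adjoints on both sides leaves the case of positive powers with x and
   y exchanged. *)
by rewrite /zpow adj adjT (si_conj hos) fwd -(si_conj hs).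
Qed.
End OrbitFormMaps.

(** * Dilation of a tuple *)

Section OneStep.
Variables (R : realType) (I : eqType) (q : I -> I -> R[i]).
Hypothesis q_unit : forall i j, i != j -> q i j * Num.conj (q i j) = 1.
Hypothesis q_sym : forall i j, i != j -> q j i = Num.conj (q i j).

(** The relations are asked for all distinct i and j, so that any index can be dilated at any
    stage. *)
Definition qtuple (V : lmodType R[i]) (s : V -> V -> R[i])
    (A A' : I -> {linear V -> V}) :=
  [/\ semi_inner s, forall i, adjoint_pair s s (A i) (A' i),
      forall i x, sqnorm s (A i x) <= sqnorm s x,
      forall i j, i != j -> forall x, A i (A j x) = q i j *: A j (A i x)
    & forall i j, i != j -> forall x,
        A i (A' j x) = Num.conj (q i j) *: A' j (A i x)].

(* [word] is [oprod] over an arbitrary list of indices. *)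
Definition word (T : Type) (A A' : I -> T -> T) (m : I -> int) (l : seq I) : T -> T :=
  foldr (fun i g => zpow (A i) (A' i) (m i) \o g) id l.

Lemma zpow_adjoint (V : lmodType R[i]) (s : V -> V -> R[i]) (f f' : V -> V) m :
  semi_inner s -> adjoint_pair s s f f' ->
  adjoint_pair s s (zpow f f' m) (zpow f' f m).
Proof.
move=> hs ff'.
have iter_adjoint n g g' : adjoint_pair s s g g' ->
    adjoint_pair s s (iter n g) (iter n g').
  by move=> gg'; elim: n => // n ih x y; rewrite iterS iterSr gg' ih.
by case: m => n; apply: iter_adjoint => //; apply: adjoint_pairC.
Qed.

Lemma zpow_intertwine (T1 T2 : Type) (f f' : T1 -> T1) (g g' : T2 -> T2)
    (j : T1 -> T2) m x :
  (forall x, g (j x) = j (f x)) -> (forall x, g' (j x) = j (f' x)) ->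
  zpow g g' m (j x) = j (zpow f f' m x).
Proof.
by move=> h h'; case: m => n; rewrite /zpow; [elim: n|elim: n.+1] => // n' /= ->.
Qed.

(** [i0] becomes the shift and every other index a twist. In a word, letters before [i0] pass to the
    right argument as adjoints and act there on an embedded vector as the original operators do;
    letters after [i0] act so on the left, since [l] has no repetition. The power of [i0] in between
    is dilated by the shift. *)
Lemma unitary_step (V : lmodType R[i]) (s : V -> V -> R[i])
    (A A' : I -> {linear V -> V}) (i0 : I) : qtuple s A A' ->
  exists (W : lmodType R[i]) (t : W -> W -> R[i]) (B B' : I -> {linear W -> W})
      (j : V -> W),
    [/\ qtuple t B B',
        forall i, i = i0 \/ cancel (A i) (A' i) /\ cancel (A' i) (A i) ->
          cancel (B i) (B' i) /\ cancel (B' i) (B i),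
        forall a x y, j (a *: x + y) = a *: j x + j y,
        (forall x y, t (j x) (j y) = s x y) /\
          (forall w, exists p, forall x, t w (j x) = s p x)
      & forall m l, uniq l -> forall x y,
          t (word B B' m l (j x)) (j y) = s (word A A' m l x) y].
Proof.
move=> [hs adjA contrA AA AA']; pose T := A i0; pose os := orbit_form s (T := T).
have hos : semi_inner os := semi_inner_orbit_form hs (contrA i0).
have neq i : i != i0 -> i0 != i by rewrite eq_sym.
have qN0 i : i != i0 -> q i0 i != 0.
  move=> /neq/q_unit; apply: contra_eq_neq => ->.
  by rewrite mul0r eq_sym oner_eq0.
have cqN0 i : i != i0 -> Num.conj (q i0 i) != 0 by move=> /qN0; rewrite conjC_eq0.
(* A twist takes a proof of [i != i0], so the operators are specified by [P] and then chosen, rather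
   than defined by cases. *)
pose P i (f : {linear orbits T -> orbits T} * {linear orbits T -> orbits T}) :=
  (i = i0 -> f.1 =1 @forward _ _ T /\ f.2 =1 @backward _ _ T) /\
  (forall ne : i != i0, f.1 =1 twist (qN0 _ ne) (AA _ _ (neq _ ne)) /\
    f.2 =1 twist (cqN0 _ ne) (AA' _ _ (neq _ ne))).
have [i|F hF] := choice (P := P).
  have [->|ne] := eqVneq i i0.
    exists (@forward _ _ T : {linear _ -> _}, @backward _ _ T : {linear _ -> _}).
    by split=> // ne; case/eqP: (ne).
  exists (twist (qN0 _ ne) (AA _ _ (neq _ ne)) : {linear _ -> _},
    twist (cqN0 _ ne) (AA' _ _ (neq _ ne)) : {linear _ -> _}).
  split=> [ii0|ne']; first by case/eqP: (ne).
  by rewrite (bool_irrelevance ne' ne).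
have F1 i (ne : i != i0) := ((hF i).2 ne).1.
have F2 i (ne : i != i0) := ((hF i).2 ne).2.
have F01 := ((hF i0).1 erefl).1; have F02 := ((hF i0).1 erefl).2.
have q_unitC i : i != i0 -> Num.conj (q i0 i) * q i0 i = 1.
  by move=> /neq/q_unit; rewrite mulrC.
have adjF i : adjoint_pair os os (F i).1 (F i).2.
  move=> x y; have [->|ne] := eqVneq i i0.
    by rewrite F01 F02; apply: (forward_backward_adjoint hs (contrA i0)).
  rewrite (F1 _ ne) (F2 _ ne).
  exact: (twist_adjoint hs (contrA i0) _ _ _ _ (adjA i)).
have intF i x : i != i0 ->
    (F i).1 (orbit_of T x) = orbit_of T (A i x) /\
    (F i).2 (orbit_of T x) = orbit_of T (A' i x).
  by move=> ne; rewrite (F1 _ ne) (F2 _ ne) !twist_orbit_of.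
exists (orbits T), os, (fun i => (F i).1), (fun i => (F i).2), (@orbit_of _ _ T).
split.
- split=> //.
  + move=> i w; have [->|ne] := eqVneq i i0.
      by rewrite /sqnorm adjF F01 F02 forwardK.
    rewrite (F1 _ ne).
    apply: (twist_contraction hs (contrA i0) _ _ (AA' _ _ (neq _ ne)) (adjA i)) => //.
    exact: q_unit (neq _ ne).
  + move=> i j ij w; have [ii0|nei] := eqVneq i i0.
      have nej : j != i0 by rewrite -ii0 eq_sym.
      by rewrite ii0 (F1 _ nej) !F01 forward_twist (F1 _ nej).
    have [ji0|nej] := eqVneq j i0.
      rewrite ji0 !(F1 _ nei) !F01 forward_twist scalerA.
      by rewrite (q_sym (neq _ nei)) q_unitC// scale1r.
    rewrite !(F1 _ nei) !(F1 _ nej).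
    exact: (twist_commute _ _ _ _ _ (AA _ _ ij)).
  + move=> i j ij w; have [ii0|nei] := eqVneq i i0.
      have nej : j != i0 by rewrite -ii0 eq_sym.
      by rewrite ii0 (F2 _ nej) !F01 forward_twist (F2 _ nej).
    have [ji0|nej] := eqVneq j i0.
      (* As [forward] is injective, the relation with [backward] follows from the one with
         [forward]. *)
      rewrite ji0 !(F1 _ nei) !F02 (q_sym (neq _ nei)) conjCK.
      rewrite -linearZ /=; apply: (can_inj (@forwardK _ _ T)).
      by rewrite backwardK forward_twist backwardK.
    rewrite !(F1 _ nei) !(F2 _ nej).
    exact: (twist_commute _ _ _ _ _ (AA' _ _ ij)).
- move=> i hi; have [ii0|nei] := eqVneq i i0.
    by rewrite ii0; split=> w; rewrite F01 F02 ?forwardK ?backwardK.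
  have [hK h'K] : cancel (A i) (A' i) /\ cancel (A' i) (A i).
    by case: hi => // ii0; rewrite ii0 eqxx in nei.
  split=> w; rewrite (F1 _ nei) (F2 _ nei); apply: twist_cancel => //.
  + exact: q_unit (neq _ nei).
  + exact: q_unitC.
- exact: orbit_of_linear.
- split; first exact: orbit_of_isometry.
  exact: (orbit_of_coadjoint hs (adjA i0)).
- move=> m; elim=> [|i l ih] /=; first by move=> _ x y; apply: orbit_of_isometry.
  move=> /andP[il ul] x y; have [ii0|nei] := eqVneq i i0.
    have -> z : word (fun i => (F i).1) (fun i => (F i).2) m l (orbit_of T z)
        = orbit_of T (word A A' m l z).
      elim: l il {ih ul} => [//|i' l ih]; rewrite inE negb_or => /andP[ii' il']. 
      have ne : i' != i0 by rewrite -ii0 eq_sym.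
      by rewrite /= ih//; apply: zpow_intertwine => v; case: (intF _ v ne).
    rewrite ii0 -(power_dilation hs (adjA i0) (contrA i0)); congr (os _ _).
    case: (m i0) => n; rewrite /zpow; [elim: n|elim: n.+1] => //= n' ->.
      by rewrite F01.
    by rewrite F02.
  rewrite (zpow_adjoint _ hos (adjF i)) (zpow_adjoint _ hs (adjA i)) -ih//.
  by congr (os _ _); apply: zpow_intertwine => v; case: (intF _ v nei).
Qed.
End OneStep.

Section Iterate.
Variables (R : realType) (I : eqType) (q : I -> I -> R[i]).
Hypothesis q_unit : forall i j, i != j -> q i j * Num.conj (q i j) = 1.
Hypothesis q_sym : forall i j, i != j -> q j i = Num.conj (q i j).

(** Induction on [r]: each [unitary_step] makes one more index unitary and keeps the earlier ones;
    the embeddings compose, and so do the projections p. *)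
Lemma unitary_dilation (V : lmodType R[i]) (s : V -> V -> R[i])
    (A A' : I -> {linear V -> V}) (r : seq I) : qtuple q s A A' ->
  exists (W : lmodType R[i]) (t : W -> W -> R[i]) (B B' : I -> {linear W -> W})
      (j : V -> W),
    [/\ qtuple q t B B',
        forall i, i \in r -> cancel (B i) (B' i) /\ cancel (B' i) (B i),
        forall a x y, j (a *: x + y) = a *: j x + j y,
        (forall x y, t (j x) (j y) = s x y) /\
          (forall w, exists p, forall x, t w (j x) = s p x)
      & forall m l, uniq l -> forall x y,
          t (word B B' m l (j x)) (j y) = s (word A A' m l x) y].
Proof.
move=> hA; elim: r => [|i0 r [W [t [B [B' [j [hB cB jlin [jiso jadj] dil]]]]]]].
  by exists V, s, A, A', id; split=> //; split=> // w; exists w.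
have [X [u [C [C' [g [hC cC glin [giso gadj] dil']]]]]] :=
  unitary_step q_unit q_sym i0 hB.
exists X, u, C, C', (g \o j); split=> //.
- by move=> i; rewrite inE => /orP[/eqP ->|/cB ?]; apply: cC; [left|right].
- by move=> a x y /=; rewrite jlin glin.
- split=> [x y|w]; first by rewrite /= giso.
  have [p hp] := gadj w; have [p' hp'] := jadj p.
  by exists p' => x; rewrite /= hp hp'.
- by move=> m l ul x y; rewrite /= dil'// dil.
Qed.
End Iterate.

(** * Completion *)

Section Vanish.
Variable R : realType.
Implicit Types a b : nat -> nat -> R.

(** One notion for two uses: both indices matter in Cauchy conditions, the second is a dummy in
    limits. The bound is one-sided, being meant for nonnegative quantities. *)
Definition vanish a := forall e : R, 0 < e ->
  exists N : nat, forall m n, (N <= m)%N -> (N <= n)%N -> a m n < e.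

Lemma vanish_le a b (c : R) : 0 <= c ->
  (exists N : nat, forall m n, (N <= m)%N -> (N <= n)%N -> a m n <= c * b m n) ->
  vanish b -> vanish a.
Proof.
move=> c0 [N1 hab] hb e e0; have c1 : 0 < c + 1 by lra.
(* The denominator is c + 1 because c may be 0. *)
have [N2 hN2] := hb (e / (c + 1)) (divr_gt0 e0 c1).
exists (maxn N1 N2) => m n; rewrite !geq_max => /andP[m1 m2] /andP[n1 n2].
apply: le_lt_trans (hab _ _ m1 n1) _.
apply: le_lt_trans (ler_wpM2l c0 (ltW (hN2 _ _ m2 n2))) _.
by rewrite mulrA ltr_pdivrMr// mulrDr mulr1 mulrC ltrDl.
Qed.

Lemma vanishD a b : vanish a -> vanish b -> vanish (fun m n => a m n + b m n).
Proof.
move=> ha hb e e0; have e2 : 0 < e / 2 by lra.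
have [N1 h1] := ha _ e2; have [N2 h2] := hb _ e2.
exists (maxn N1 N2) => m n; rewrite !geq_max => /andP[m1 m2] /andP[n1 n2].
by have := h1 m n m1 n1; have := h2 m n m2 n2; lra.
Qed.

Lemma vanish_comb a b d (c c' : R) : 0 <= c -> 0 <= c' ->
  (exists N : nat, forall m n, (N <= m)%N -> (N <= n)%N ->
    d m n <= c * a m n + c' * b m n) ->
  vanish a -> vanish b -> vanish d.
Proof.
move=> c0 c'0 hd ha hb.
apply: (@vanish_le _ (fun m n => c * a m n + c' * b m n) 1) => //.
  by under eq_exists do under eq_forall do under eq_forall do rewrite mul1r.
apply: vanishD; [apply: (vanish_le c0 _ ha)|apply: (vanish_le c'0 _ hb)];
  by exists 0%N.
Qed.

Lemma vanish_cst (x : R) : 0 <= x -> vanish (fun _ _ => x) -> x = 0.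
Proof.
move=> x0 h; apply/eqP; rewrite eq_le x0 andbT leNgt; apply/negP => {}x0.
by have [N /(_ N N (leqnn _) (leqnn _))] := h x x0; rewrite ltxx.
Qed.

Lemma vanish_sqrt a : vanish (fun m n => a m n ^+ 2) -> vanish a.
Proof.
move=> h e e0; have [N hN] := h (e ^+ 2) (exprn_gt0 _ e0).
by exists N => m n hm hn; have := hN m n hm hn; nra.
Qed.

(** The limit is obtained as the limit inferior, the supremum of the numbers eventually below the
    sequence. *)
Lemma real_complete (a : nat -> R) : vanish (fun m n => (a m - a n) ^+ 2) ->
  exists l, vanish (fun n _ => (a n - l) ^+ 2).
Proof.
move=> ha.
pose E : set R := fun x => exists N : nat, forall n, (N <= n)%N -> x <= a n.
have inE e : 0 < e -> exists N : nat, forall n, (N <= n)%N -> E (a n - e) /\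
    (forall x, E x -> x <= a n + e).
  move=> e0; have [N hN] := ha (e ^+ 2) (exprn_gt0 _ e0).
  have close m n : (N <= m)%N -> (N <= n)%N -> a n - e <= a m.
    by move=> hm hn; have := hN m n hm hn; nra.
  exists N => n hn; split; first by exists N => m hm; exact: close.
  move=> x [M hM]; have := hM _ (leq_maxl M N).
  by have := close n _ hn (leq_maxr M N); lra.
have supE : has_sup E.
  have [N /(_ N (leqnn _)) [EN ubN]] := inE 1 ltr01.
  by split; [exists (a N - 1)|exists (a N + 1)].
exists (reals.sup E) => e e0.
(* As d <= 1, a distance of at most d has square at most d, hence at most e / 2. *)
pose d := Num.min 1 (e / 2).
have d0 : 0 < d by rewrite lt_min ltr01 /=; lra.
have [N hN] := inE d d0; exists N => n _ hn _.
have [En ubn] := hN n hn.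
have lo : a n - d <= reals.sup E by apply: ub_le_sup => //; case: supE.
have hi : reals.sup E <= a n + d by apply: ge_sup => //; case: supE.
have d1 : d <= 1 by rewrite ge_min lexx.
have de : d <= e / 2 by rewrite ge_min lexx orbT.
nra.
Qed.
End Vanish.

(** * Limits for the seminorm *)

Section Limits.
Variables (R : realType) (V : lmodType R[i]) (s : V -> V -> R[i]).
Hypothesis hs : semi_inner s.
Local Notation N := (sqnorm s).
Implicit Types (u w : nat -> V).

Definition tends u (l : V) := vanish (fun n _ => N (u n - l)).
Definition cauchy u := vanish (fun m n => N (u m - u n)).

Lemma sqnorm_comb a x y :
  N (a *: x + y) <= 2 * complex.Re (a * Num.conj a) * N x + 2 * N y.
Proof.
apply: le_trans (sqnormD_le hs _ _) _; rewrite lerD2r -mulrA ler_pM2l//.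
by rewrite -[a *: x]add0r (sqnormP hs) (si0l hs) /sqnorm (si0l hs) mulr0 /= mulr0 !add0r.
Qed.

Lemma cauchy_comb a u w : cauchy u -> cauchy w -> cauchy (fun n => a *: u n + w n).
Proof.
apply: (@vanish_comb _ _ _ _ (2 * complex.Re (a * Num.conj a)) 2) => //.
  by rewrite mulr_ge0// sqmod_ge0.
exists 0%N => m n _ _; apply: le_trans (sqnorm_comb _ _ _).
by rewrite scalerBr opprD addrACA.
Qed.

Lemma tends_comb a u w l k : tends u l -> tends w k ->
  tends (fun n => a *: u n + w n) (a *: l + k).
Proof.
apply: (@vanish_comb _ _ _ _ (2 * complex.Re (a * Num.conj a)) 2) => //.
  by rewrite mulr_ge0// sqmod_ge0.
exists 0%N => m n _ _; apply: le_trans (sqnorm_comb _ _ _).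
by rewrite scalerBr opprD addrACA.
Qed.

Lemma cauchy_cst v : cauchy (fun=> v).
Proof. by move=> e e0; exists 0%N => m n _ _; rewrite subrr /sqnorm (si0l hs). Qed.

Lemma tends_cst v : tends (fun=> v) v.
Proof. by move=> e e0; exists 0%N => m n _ _; rewrite subrr /sqnorm (si0l hs). Qed.

Lemma tends_unique u l k : tends u l -> tends u k -> N (l - k) = 0.
Proof.
move=> ul uk; apply: vanish_cst; first exact: sqnorm_ge0.
apply: (vanish_comb _ _ _ ul uk); try exact: (ler0n R 2).
exists 0%N => m _ _ _; rewrite (sqnormB hs (u m) l).
by apply: le_trans (sqnormD_le hs (l - u m) (u m - k)); rewrite addrA subrK.
Qed.

Lemma cauchy_bounded u : cauchy u ->
  exists M : R, 0 <= M /\ exists K : nat, forall n, (K <= n)%N -> N (u n) <= M.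
Proof.
move=> /(_ 1 ltr01)[K hK]; have := sqnorm_ge0 hs (u K).
exists (2 + 2 * N (u K)); split; first by lra.
exists K => n hn; have := sqnormD_le hs (u n - u K) (u K).
by rewrite subrK; have := hK n K hn (leqnn _); lra.
Qed.
End Limits.

(** * Limits of scalars and of the form *)

Section FormLimits.
Variables (R : realType) (V : lmodType R[i]) (s : V -> V -> R[i]).
Hypothesis hs : semi_inner s.
Local Notation N := (sqnorm s).
Implicit Types (u w : nat -> V).
Local Notation ctends := (tends (@mulconj R)).
Let hc := @semi_inner_mulconj R.

Lemma sqnorm_form x y : sqnorm (@mulconj R) (s x y) <= N x * N y.
Proof. exact: cauchy_schwarz. Qed.

Lemma ctends_unique (z : nat -> R[i]) l k : ctends z l -> ctends z k -> l = k.
Proof.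
move=> zl zk; apply/eqP; rewrite -subr_eq0.
have := tends_unique hc zl zk; rewrite /sqnorm /mulconj.
case: (l - k) => a b /= h; have -> : a = 0 by nra.
by have -> : b = 0 by nra.
Qed.

Lemma ctends_ext (z z' : nat -> R[i]) l : z =1 z' -> ctends z l -> ctends z' l.
Proof. by move=> /funext ->. Qed.

Lemma ctends_conj (z : nat -> R[i]) l :
  ctends z l -> ctends (fun n => Num.conj (z n)) (Num.conj l).
Proof.
apply: (vanish_le ler01); exists 0%N => m _ _ _; rewrite mul1r /sqnorm /mulconj.
by rewrite -rmorphB /= conjCK mulrC.
Qed.

Lemma form_continuous u l v : tends s u l -> ctends (fun n => s (u n) v) (s l v).
Proof.
apply: (vanish_le (sqnorm_ge0 hs v)); exists 0%N => m _ _ _.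
by rewrite -(siBl hs) mulrC sqnorm_form.
Qed.

Lemma cauchy_form u w : cauchy s u -> cauchy s w ->
  cauchy (@mulconj R) (fun n => s (u n) (w n)).
Proof.
move=> cu cw; have [Mu [Mu0 [Ku hu]]] := cauchy_bounded hs cu.
have [Mw [Mw0 [Kw hw]]] := cauchy_bounded hs cw.
apply: (vanish_comb (c := 2 * Mw) (c' := 2 * Mu) _ _ _ cu cw); try by rewrite mulr_ge0.
exists (maxn Ku Kw) => m n; rewrite !geq_max => /andP[mu mw] /andP[nu nw].
have -> : s (u m) (w m) - s (u n) (w n) = s (u m - u n) (w m) + s (u n) (w m - w n).
  by rewrite (siBl hs) (siBr hs) addrA subrK.
apply: le_trans (sqnormD_le hc _ _) _; rewrite -!mulrA.
apply: lerD; rewrite ler_pM2l//; apply: le_trans (sqnorm_form _ _) _.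
  by rewrite mulrC ler_wpM2r ?sqnorm_ge0// hw.
by rewrite ler_wpM2r ?sqnorm_ge0// hu.
Qed.

Lemma complex_complete (z : nat -> R[i]) : cauchy (@mulconj R) z -> exists l, ctends z l.
Proof.
move=> hz; have sq (x : R[i]) : sqnorm (@mulconj R) x = complex.Re x ^+ 2 + complex.Im x ^+ 2.
  by rewrite /sqnorm /mulconj; case: x => a b /=; ring.
have ReB (x y : R[i]) : complex.Re (x - y) = complex.Re x - complex.Re y.
  by case: x => ? ?; case: y.
have ImB (x y : R[i]) : complex.Im (x - y) = complex.Im x - complex.Im y.
  by case: x => ? ?; case: y.
have [x hx] : exists x, vanish (fun n _ => (complex.Re (z n) - x) ^+ 2).
  apply: real_complete; apply: (vanish_le ler01 _ hz); exists 0%N => m n _ _.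
  by rewrite mul1r sq ReB lerDl sqr_ge0.
have [y hy] : exists y, vanish (fun n _ => (complex.Im (z n) - y) ^+ 2).
  apply: real_complete; apply: (vanish_le ler01 _ hz); exists 0%N => m n _ _.
  by rewrite mul1r sq ImB lerDr sqr_ge0.
exists (Complex x y); apply: (vanish_le ler01 _ (vanishD hx hy)).
by exists 0%N => m n _ _; rewrite mul1r sq ReB ImB.
Qed.

(** N(u_m) = <u_m, u_m - u_P> + <u_m, u_P> with P large and fixed: the first term is small by the
    Cauchy condition and Cauchy-Schwarz, the second by weak convergence. *)
Lemma weakly_null u : cauchy s u -> (forall v, ctends (fun n => s (u n) v) 0) ->
  tends s u 0.
Proof.
move=> cu wu; have [M [M0 [K hK]]] := cauchy_bounded hs cu.
apply: vanish_sqrt => e e0.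
(* The real part of each of the two terms will have square below e / 4, so their sum has square
   below e; M + 1 keeps the denominator positive. *)
have d0 : 0 < e / (4 * (M + 1)) by rewrite divr_gt0//; lra.
have [P hP] := cu _ d0; have [Q hQ] := wu (u P) (e / 4) ltac:(lra).
exists (maxn K (maxn P Q)) => m n; rewrite !geq_max => /and3P[mK mP mQ] _.
rewrite subr0; have := hQ m m mQ mQ; rewrite subr0.
have := sqnorm_form (u m) (u m - u P); have := hP m P mP (leqnn _).
have := hK m mK; have : N (u m) = complex.Re (s (u m) (u m - u P) + s (u m) (u P)).
  by rewrite -(siDr hs) subrK.
have nx := sqnorm_ge0 hs (u m); have ny := sqnorm_ge0 hs (u m - u P).
move: (s (u m) (u P)) (s (u m) (u m - u P)) nx ny => [a b] [c d] /=.
rewrite /sqnorm /mulconj /=; move: (complex.Re (s _ _)) => x.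
move: (complex.Re _) => y x0 y0 xac xM yd hcd hab.
have {}yd : y * (M + 1) < e / 4.
  by move: yd; rewrite ltr_pdivlMr; [lra|lra].
have a2 : a ^+ 2 < e / 4 by nra.
have c2 : c ^+ 2 <= x * y by nra.
have xy : x * y <= M * y by rewrite ler_wpM2r.
have : x ^+ 2 <= 2 * a ^+ 2 + 2 * c ^+ 2 
  by rewrite xac -subr_ge0 (_ : _ - _ = (a - c) ^+ 2) ?sqr_ge0//; ring.
lra.
Qed.
End FormLimits.

(** * The completion of a semi-inner product space *)

Section Completion.
Variables (R : realType) (V : lmodType R[i]) (s : V -> V -> R[i]).
Hypothesis hs : semi_inner s.
Local Notation N := (sqnorm s).
Local Notation ctends := (tends (@mulconj R)).

Definition represents (phi : V -> R[i]) (u : nat -> V) :=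
  cauchy s u /\ forall v, ctends (fun n => s (u n) v) (phi v).

(* The completion is realized inside the antilinear functionals on V, as the
   weak limits of Cauchy sequences, so no quotient by null vectors is needed.
   The proof of [semi_inner s] is an argument only so that the submodule
   instance can recover it. *)
Definition weak_limits (_ : semi_inner s) : {pred (V -> R[i]^o)} :=
  fun phi => `[< exists u, represents phi u >].

Lemma represents_comb a phi psi u w : represents phi u -> represents psi w ->
  represents (fun v => a * phi v + psi v) (fun n => a *: u n + w n).
Proof.
move=> [cu hu] [cw hw]; split; first exact: cauchy_comb.
move=> v; have := tends_comb (@semi_inner_mulconj R) a (hu v) (hw v).
by apply: ctends_ext => n; rewrite (siP hs).
Qed.

Lemma weak_limits_submod : submod_closed (weak_limits hs).
Proof.
split=> [|a phi psi /asboolP[u hu] /asboolP[w hw]]; apply/asboolP.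
  exists (fun=> 0); split=> [|v]; first exact: cauchy_cst.
  by rewrite (si0l hs); apply: (tends_cst (@semi_inner_mulconj R)).
by exists (fun n => a *: u n + w n); apply: represents_comb.
Qed.
HB.instance Definition _ :=
  GRing.isSubmodClosed.Build _ _ (weak_limits hs) weak_limits_submod.

Record completion :=
  Completion { functional :> V -> R[i]^o; _ : functional \in weak_limits hs }.
HB.instance Definition _ := [isSub for functional].
HB.instance Definition _ := [Choice of completion by <:].
HB.instance Definition _ := [SubChoice_isSubLmodule of completion by <:].
Implicit Types phi psi : completion.

Lemma completionP phi : exists u, represents phi u.
Proof. by have /asboolP := valP phi. Qed.

Lemma completion_eq phi psi : (forall v, phi v = psi v) -> phi = psi.
Proof. by move=> h; apply: val_inj; apply/funext. Qed.

Lemma completionPE a phi psi v : (a *: phi + psi) v = a * phi v + psi v.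
Proof. by []. Qed.

Lemma represents_linear a phi psi u w : represents phi u -> represents psi w ->
  represents (functional (a *: phi + psi)) (fun n => a *: u n + w n).
Proof. exact: represents_comb. Qed.

Definition completion_of (phi : V -> R[i]) (h : exists u, represents phi u) :=
  Completion (asboolT h : (phi : V -> R[i]^o) \in weak_limits hs).

Lemma represents_unique phi psi u : represents phi u -> represents psi u -> phi = psi.
Proof.
move=> [_ h] [_ k]; apply: completion_eq => v; exact: ctends_unique (h v) (k v).
Qed.

Lemma completion_form_subproof phi psi : exists l,
  forall u w, represents phi u -> represents psi w ->
    ctends (fun n => s (u n) (w n)) l.
Proof.
have [u0 hu0] := completionP phi; have [w0 hw0] := completionP psi.
have [l hl] := complex_complete (cauchy_form hs hu0.1 hw0.1).
exists l => u w hu hw.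
(* Two representatives of one functional differ by a weakly null Cauchy sequence, hence by a null
   sequence. *)
have null (f g : nat -> V) (chi : V -> R[i]) : represents chi f -> represents chi g ->
    tends s (fun n => f n - g n) 0.
  move=> hf hg; apply: (weakly_null hs).
    have := cauchy_comb hs (-1) hg.1 hf.1.
    by congr cauchy; apply/funext => n; rewrite scaleN1r addrC.
  move=> v; have := tends_comb (@semi_inner_mulconj R) (-1) (hg.2 v) (hf.2 v).
  rewrite scaleN1r addNr; apply: ctends_ext => n.
  by rewrite (siBl hs) scaleN1r addrC.
have bounded (f d : nat -> V) : cauchy s f -> tends s d 0 ->
    ctends (fun n => s (d n) (f n)) 0.
  move=> cf hd; have [M [M0 [K hK]]] := cauchy_bounded hs cf.
  apply: (vanish_le M0 _ hd); exists K => m n hm _; rewrite !subr0.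
  apply: le_trans (sqnorm_form hs _ _) _; rewrite mulrC.
  by rewrite ler_wpM2r ?sqnorm_ge0// hK.
have h1 := bounded _ _ hw.1 (null _ _ _ hu hu0).
have h2 := ctends_conj (bounded _ _ hu0.1 (null _ _ _ hw hw0)).
(* s(u, w) = s(u - u0, w) + s(u0, w - w0) + s(u0, w0), where the first two terms tend to 0. *)
have := tends_comb (@semi_inner_mulconj R) 1 h1 (tends_comb (@semi_inner_mulconj R) 1 h2 hl).
rewrite !scale1r conjC0 !add0r; apply: ctends_ext => n.
by rewrite !scale1r -(si_conj hs) (siBl hs) (siBr hs) subrK subrK.
Qed.

Definition completion_form phi psi : R[i] := projT1 (cid (completion_form_subproof phi psi)).

Lemma completion_formP phi psi u w : represents phi u -> represents psi w ->
  ctends (fun n => s (u n) (w n)) (completion_form phi psi).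
Proof. exact: (projT2 (cid (completion_form_subproof phi psi))). Qed.

Lemma completion_form_semi_inner : semi_inner completion_form.
Proof.
split=> [a x y z|x y|x].
- have [u hu] := completionP x; have [w hw] := completionP y.
  have [t ht] := completionP z.
  apply: (ctends_unique (completion_formP (represents_linear a hu hw) ht)).
  have := tends_comb (@semi_inner_mulconj R) a (completion_formP hu ht) (completion_formP hw ht).
  by apply: ctends_ext => n; rewrite (siP hs).
- have [u hu] := completionP x; have [w hw] := completionP y.
  apply: (ctends_unique (completion_formP hw hu)).
  have := ctends_conj (completion_formP hu hw).
  by apply: ctends_ext => n; rewrite -(si_conj hs).
- have [u hu] := completionP x; have hl := completion_formP hu hu.
  move: (completion_form x x) hl => [a b] hl; rewrite lecE /=.
  (* The values are real and nonnegative, so their squared distance to a + ib is at least b^2 and,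
     if a < 0, at least a^2. *)
  have h n : sqnorm (@mulconj R) (s (u n) (u n) - Complex a b)
      = (sqnorm s (u n) - a) ^+ 2 + b ^+ 2.
    by rewrite (sqnormE hs) /sqnorm /mulconj /=; ring.
  have b0 : b ^+ 2 = 0.
    apply: vanish_cst; first exact: sqr_ge0.
    apply: (vanish_le ler01 _ hl); exists 0%N => m n _ _.
    by rewrite mul1r h lerDr sqr_ge0.
  have -> : b = 0 by nra.
  rewrite eqxx /= leNgt; apply/negP => a0.
  have [K /(_ K K (leqnn _) (leqnn _))] := hl (a ^+ 2) ltac:(nra).
  rewrite h; have := sqnorm_ge0 hs (u K); nra.
Qed.

Local Notation K := (sqnorm completion_form).
Let hk := completion_form_semi_inner.

Lemma sqnorm_limit phi u : represents phi u ->
  vanish (fun n _ => (N (u n) - K phi) ^+ 2).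
Proof.
move=> hu; apply: (vanish_le ler01 _ (completion_formP hu hu)).
exists 0%N => n _ _ _; rewrite mul1r (sqnormE hs) (sqnormE hk).
by rewrite -rmorphB /sqnorm /mulconj /= oppr0 mulr0 subr0 -expr2.
Qed.

Lemma completion_form_ge0 phi : 0 <= completion_form phi phi.
Proof. by case: hk. Qed.

(** If the norm of phi vanishes, a representing sequence u tends to 0 in seminorm, so each value of
    phi, being the limit of s(u_n, v), is 0. *)
Lemma completion_form_eq0 phi : completion_form phi phi = 0 -> phi = 0.
Proof.
move=> h0; have [u hu] := completionP phi.
have K0 : K phi = 0 by rewrite /sqnorm h0.
have u0 : tends s u 0.
  apply: vanish_sqrt; apply: (vanish_le ler01 _ (sqnorm_limit hu)).
  by exists 0%N => n _ _ _; rewrite K0 !subr0 mul1r.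
apply: completion_eq => v; apply: (ctends_unique (hu.2 v)).
by have := form_continuous hs v u0; rewrite (si0l hs).
Qed.

Lemma sqnorm_completion_le phi u e : represents phi u ->
  (exists P : nat, forall n, (P <= n)%N -> N (u n) <= e) -> K phi <= e.
Proof.
move=> hu [P hP]; rewrite leNgt; apply/negP => lt_e.
have [Q hQ] := sqnorm_limit hu (e := (K phi - e) ^+ 2) ltac:(nra).
have := hQ _ _ (leq_maxr P Q) (leq_maxr P Q); have := hP _ (leq_maxl P Q).
nra.
Qed.

Lemma inclusion_subproof v : exists u, represents (s v) u.
Proof.
exists (fun=> v); split; first exact: cauchy_cst.
by move=> w; apply: (tends_cst (@semi_inner_mulconj R)).
Qed.

(** Null vectors of V become 0 here, by Cauchy-Schwarz. *)
Definition inclusion v : completion := completion_of (inclusion_subproof v).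

Lemma represents_inclusion v : represents (inclusion v) (fun=> v).
Proof.
split; first exact: cauchy_cst.
by move=> w; apply: (tends_cst (@semi_inner_mulconj R)).
Qed.

Lemma inclusion_linear a x y :
  inclusion (a *: x + y) = a *: inclusion x + inclusion y.
Proof. by apply: completion_eq => v; rewrite completionPE /= (siP hs). Qed.

Lemma inclusion_isometry x y : completion_form (inclusion x) (inclusion y) = s x y.
Proof.
apply: ctends_unique (tends_cst (@semi_inner_mulconj R) (s x y)).
exact: (completion_formP (represents_inclusion x) (represents_inclusion y)).
Qed.

Lemma sqnorm_inclusionB x y : K (inclusion x - inclusion y) = N (x - y).
Proof.
have <- : inclusion (x - y) = inclusion x - inclusion y.
  by have := inclusion_linear (-1) y x; rewrite !scaleN1r ![- _ + _]addrC.
by rewrite /sqnorm inclusion_isometry.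
Qed.

Lemma inclusion_tends phi u : represents phi u ->
  tends completion_form (fun n => inclusion (u n)) phi.
Proof.
move=> hu e e0; have [P hP] := hu.1 (e / 2) ltac:(lra).
exists P => n _ hn _; apply: (@le_lt_trans _ _ (e / 2)); last by lra.
rewrite addrC -scaleN1r.
(* For fixed n the difference is represented by u_n - u_m as a sequence in m. *)
apply: (sqnorm_completion_le (represents_linear (-1) hu (represents_inclusion (u n)))).
exists P => m hm; rewrite scaleN1r addrC; exact/ltW/hP.
Qed.

(** By density, f_n is replaced by an included vector v_n at squared distance below 1/(n+1); v is
    Cauchy in V, and the functional that it represents is the limit of f. *)
Lemma completion_complete (f : nat -> completion) :
  cauchy completion_form f -> exists l, tends completion_form f l.
Proof.
move=> cf.
have /choice[v hv] : forall n, exists v, K (inclusion v - f n) < n.+1%:R^-1.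
  move=> n; have [u hu] := completionP (f n).
  have [P hP] := inclusion_tends hu (e := n.+1%:R^-1) ltac:(by rewrite invr_gt0).
  by exists (u P); apply: (hP P P).
have near : vanish (fun n _ => K (inclusion (v n) - f n)).
  move=> e e0; exists (Num.bound e^-1) => n _ hn _; apply: lt_trans (hv n) _.
  rewrite invf_plt ?posrE//; apply: lt_le_trans (archi_boundP _) _.
    by rewrite invr_ge0 ltW.
  by rewrite ler_nat leqW.
have near' : vanish (fun _ n => K (inclusion (v n) - f n)).
  by move=> e /near[P hP]; exists P => m n hm hn; apply: hP hm.
have cv : cauchy s v.
  (* Going through f_m and then f_n gives the coefficients 2, 4 and 4; the 2 is weakened to 4. *)
  apply: (vanish_comb (c := 4) (c' := 4) _ _ _ near
    (vanish_comb (c := 1) (c' := 1) _ _ _ near' cf)) => //; last first.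
    exists 0%N => m n _ _; exact: lexx.
  exists 0%N => m n _ _; rewrite -sqnorm_inclusionB.
  have h1 := sqnormD_le hk (inclusion (v m) - f m) (f m - inclusion (v n)).
  have h2 := sqnormD_le hk (f m - f n) (f n - inclusion (v n)).
  move: h1 h2; rewrite !addrA !subrK (sqnormB hk (f n)) => h1 h2.
  have := sqnorm_ge0 hk (inclusion (v m) - f m); move: h1 h2.
  by do 5![move: (K _) => ?]; lra.
have [phi hphi] := choice (fun x => complex_complete
  (cauchy_form hs cv (cauchy_cst hs x))).
have rv : represents phi v by split.
exists (completion_of (ex_intro _ v rv)).
have hp : represents (completion_of (ex_intro _ v rv)) v by [].
apply: (vanish_comb (c := 2) (c' := 2) _ _ _ near (inclusion_tends hp)) => //.
exists 0%N => n _ _ _; rewrite (sqnormB hk (inclusion (v n)) (f n)).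
apply: le_trans (sqnormD_le hk (f n - inclusion (v n)) (inclusion (v n) - _)).
by rewrite addrA subrK.
Qed.

Lemma completion_complete_lt (f : nat -> completion) :
  (forall e : R, 0 < e -> exists N : nat, forall m n, (N <= m)%N -> (N <= n)%N ->
    completion_form (f m - f n) (f m - f n) < e%:C%C) ->
  exists l, forall e : R, 0 < e -> exists N : nat, forall n, (N <= n)%N ->
    completion_form (f n - l) (f n - l) < e%:C%C.
Proof.
move=> hf; have [e /hf[P hP]|l hl] := completion_complete (f := f).
  by exists P => m n hm hn; rewrite -(sqnorm_lt hk) hP.
exists l => e /hl[P hP]; exists P => n hn.
by rewrite (sqnorm_lt hk) (hP n n).
Qed.

Definition completion_hilbert : hilbert R :=
  Hilbert (siP hk) (si_conj hk) completion_form_ge0 completion_form_eq0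
    completion_complete_lt.

(** * Extension of unitaries to the completion *)

Section Extend.
Variables (U : {linear V -> V}) (U' : V -> V).
Hypotheses (UU' : adjoint_pair s s U U') (UK : cancel U U').

(** As <U u, v> = <u, U' v>, composing a functional with U' means applying U to its representing
    sequence, which stays Cauchy because U' U = 1 makes U isometric. *)
Lemma represents_extend phi u : represents phi u ->
  represents (fun v => phi (U' v)) (fun n => U (u n)).
Proof.
move=> [cu hu]; split=> [|v].
  apply: (vanish_le ler01 _ cu); exists 0%N => m n _ _.
  by rewrite mul1r /sqnorm -linearB UU' UK.
by have := hu (U' v); apply: ctends_ext => n; rewrite UU'.
Qed.

Lemma extend_subproof phi : exists u, represents (fun v => phi (U' v)) u.
Proof.
by have [u hu] := completionP phi; exists (fun n => U (u n)); apply: represents_extend.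
Qed.

Definition extend phi : completion := completion_of (extend_subproof phi).

Lemma extend_linear a phi psi : extend (a *: phi + psi) = a *: extend phi + extend psi.
Proof. by apply: completion_eq. Qed.

Lemma extend_inclusion v : extend (inclusion v) = inclusion (U v).
Proof. by apply: completion_eq => w /=; rewrite UU'. Qed.
End Extend.

Lemma extend_cancel (U U' : {linear V -> V}) (UU' : adjoint_pair s s U U')
    (U'U : adjoint_pair s s U' U) (UK : cancel U U') (U'K : cancel U' U) :
  cancel (extend UU' UK) (extend U'U U'K).
Proof. by move=> phi; apply: completion_eq => v /=; rewrite UK. Qed.

Lemma extend_adjoint (U U' : {linear V -> V}) (UU' : adjoint_pair s s U U')
    (U'U : adjoint_pair s s U' U) (UK : cancel U U') (U'K : cancel U' U) :
  adjoint_pair completion_form completion_form (extend UU' UK) (extend U'U U'K).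
Proof.
move=> x y; have [u hu] := completionP x; have [w hw] := completionP y.
have hUu : represents (extend UU' UK x) (fun n => U (u n)) by apply: represents_extend.
have hUw : represents (extend U'U U'K y) (fun n => U' (w n)) by apply: represents_extend.
apply: (ctends_unique (completion_formP hUu hw)).
by apply: ctends_ext (completion_formP hu hUw) => n; rewrite UU'.
Qed.

Lemma extend_commute (U1 U2 : {linear V -> V}) (U1' U2' : V -> V)
    (UU1 : adjoint_pair s s U1 U1') (UU2 : adjoint_pair s s U2 U2')
    (UK1 : cancel U1 U1') (UK2 : cancel U2 U2') (c : R[i]) phi :
  (forall x, U1 (U2 x) = c *: U2 (U1 x)) ->
  extend UU1 UK1 (extend UU2 UK2 phi) = c *: extend UU2 UK2 (extend UU1 UK1 phi).
Proof.
move=> U12; have [u hu] := completionP phi.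
have h12 : represents (extend UU1 UK1 (extend UU2 UK2 phi)) (fun n => U1 (U2 (u n))).
  by apply: represents_extend => //; apply: represents_extend.
have h21 : represents (extend UU2 UK2 (extend UU1 UK1 phi)) (fun n => U2 (U1 (u n))).
  by apply: represents_extend => //; apply: represents_extend.
have h0 : represents (0 : completion) (fun=> 0).
  split=> [|v]; first exact: cauchy_cst.
  by rewrite (si0l hs); apply: (tends_cst (@semi_inner_mulconj R)).
(* Both sides are represented by U1 U2 u_n; a zero summand brings the scalar multiple into the form
   of [represents_linear]. *)
apply: (represents_unique (u := fun n => U1 (U2 (u n)))) => //.
have := represents_linear c h21 h0; rewrite addr0.
by congr represents; apply/funext => n; rewrite addr0 U12.
Qed.

(** The projection of the completion onto H: the projections p(u_n) are Cauchy by a Bessel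
    inequality, and completeness of H supplies their limit. *)
Lemma completion_coadjoint (H : hilbert R) (j : H -> V) :
  (forall x y, s (j x) (j y) = inner x y) ->
  (forall w, exists p, forall x, s w (j x) = inner p x) ->
  forall phi, exists p, forall x, inner p x = completion_form phi (inclusion (j x)).
Proof.
move=> jiso /choice[p hp] phi; have [u hu] := completionP phi.
have hH : semi_inner (@inner _ H).
  by split; [exact: inner_linl|exact: inner_conjsym|exact: inner_ge0].
(* With d = p(u_m) - p(u_n), one has <u_m - u_n, j d> = <d, d>, and Cauchy-Schwarz applies. *)
have bessel m n : sqnorm (@inner _ H) (p (u m) - p (u n)) <= N (u m - u n).
  set d := p (u m) - p (u n).
  have := sqnorm_form hs (u m - u n) (j d).
  have -> : N (j d) = sqnorm (@inner _ H) d by rewrite /sqnorm jiso.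
  have sq (x : R) : sqnorm (@mulconj R) x%:C%C = x * x.
    by rewrite /sqnorm /mulconj /= oppr0 mulr0 subr0.
  rewrite (siBl hs) !hp -(siBl hH) -/d (sqnormE hH) sq.
  by have := sqnorm_ge0 hH d; have := sqnorm_ge0 hs (u m - u n); nra.
have [e e0|l hl] := @inner_complete R H (fun n => p (u n)).
  have [P hP] := hu.1 e e0; exists P => m n hm hn; rewrite (sqnorm_lt hH).
  exact: le_lt_trans (bessel m n) (hP m n hm hn).
exists l => x; apply: (ctends_unique (z := fun n => inner (p (u n)) x)).
  apply: (form_continuous hH) => e e0; have [P hP] := hl e e0.
  by exists P => n _ hn _; rewrite -(sqnorm_lt hH) hP.
by apply: ctends_ext (completion_formP hu (represents_inclusion (j x))) => n; rewrite hp.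
Qed.
End Completion.

(** * Bundled linear maps and adjoints on a Hilbert space *)

Lemma linear_family (R : realType) (V : lmodType R[i]) (I : Type) (f : I -> V -> V) :
  (forall i, linear (f i)) ->
  exists g : I -> {linear V -> V}, forall i, g i =1 f i.
Proof.
move=> flin; suff /choice[g hg] : forall i, exists g : {linear V -> V}, g =1 f i.
  by exists g.
move=> i; pose L := GRing.isLinear.Build R[i] V V *:%R (f i) (flin i).
by exists (HB.pack_for {linear V -> V} (f i) L).
Qed.

Lemma semi_inner_hilbert (R : realType) (H : hilbert R) : semi_inner (@inner R H).
Proof. by split; [exact: inner_linl|exact: inner_conjsym|exact: inner_ge0]. Qed.

Lemma inner_inj (R : realType) (H : hilbert R) (x y : H) :
  (forall z, inner x z = inner y z) -> x = y.
Proof.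
move=> h; apply/eqP; rewrite -subr_eq0; apply/eqP/inner_eq0.
by rewrite (siBl (semi_inner_hilbert H)) h subrr.
Qed.

(** <g u, v> = <u, f v> is linear in u, and inner products separate vectors. *)
Lemma hilbert_adjoint_linear (R : realType) (H : hilbert R) (f g : H -> H) :
  h_adjoint f g -> linear g.
Proof.
move=> fg a x y; have hH := semi_inner_hilbert H.
apply: inner_inj => z; rewrite (siP hH).
have gf u v : inner (g u) v = inner u (f v).
  by rewrite inner_conjsym -fg -inner_conjsym.
by rewrite !gf (siP hH).
Qed.

(** * The dilation theorem *)

Unset Implicit Arguments. Set Strict Implicit. Set Printing Implicit Defensive.

Theorem theorem3p6 (R : realType) (H : hilbert R) (k : nat)
    (T Ts : 'I_k -> H -> H) (q : 'I_k -> 'I_k -> R[i]) :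
  (forall i, h_contraction (T i)) ->
  (forall i, h_adjoint (T i) (Ts i)) ->
  (forall i j : 'I_k, (i < j)%N -> `|q i j| = 1) ->
  (forall i j : 'I_k, (i < j)%N ->
     forall x : H, T i (T j x) = q i j *: T j (T i x)) ->
  (forall i j : 'I_k, (i < j)%N ->
     forall x : H, T i (Ts j x) = Num.conj (q i j) *: Ts j (T i x)) ->
  exists (K : hilbert R) (J : H -> K) (Js : K -> H) (U Us : 'I_k -> K -> K),
    [/\ h_isometry J, h_adjoint J Js,
        (forall i, h_unitary (U i) (Us i)),
        (forall i j : 'I_k, (i < j)%N ->
           forall y : K, U i (U j y) = q i j *: U j (U i y)) &
        (forall (m : 'I_k -> int) (x : H),
           oprod (fun i => zpow (T i) (Ts i) (m i)) x
           = Js (oprod (fun i => zpow (U i) (Us i) (m i)) (J x)))].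
Proof.
move=> contrT adjT q1 TT TTs; have hH := semi_inner_hilbert H.
have [A hA] := linear_family (fun i => (contrT i).1).
have [A' hA'] := linear_family (fun i => hilbert_adjoint_linear (adjT i)).
have unit (i j : 'I_k) : (i < j)%N -> q i j * Num.conj (q i j) = 1.
  by move=> ij; rewrite -normCK q1// expr1n.
(* Reversing a relation inverts its unimodular scalar, that is, conjugates it; [p] extends the
   scalars to j < i accordingly. *)
pose p (i j : 'I_k) := if (i < j)%N then q i j else Num.conj (q j i).
have neqP (i j : 'I_k) : i != j -> ~~ (i < j)%N -> (j < i)%N.
  move=> ij; rewrite -leqNgt leq_eqVlt eq_sym => /orP[/eqP/val_inj/eqP|//].
  by rewrite (negPf ij).
have p_unit i j : i != j -> p i j * Num.conj (p i j) = 1.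
  move=> ij; rewrite /p; case: ifPn => [|/(neqP _ _ ij)] /unit //.
  by rewrite conjCK mulrC.
have p_sym i j : i != j -> p j i = Num.conj (p i j).
  move=> ij; rewrite /p; case: (ltngtP i j) => // [_|/val_inj ij'].
    by rewrite conjCK.
  by rewrite ij' eqxx in ij.
have adjA i : adjoint_pair (@inner _ H) (@inner _ H) (A i) (A' i).
  by move=> x y; rewrite hA hA'; apply: adjT.
have qA : qtuple p (@inner _ H) A A'.
  split=> // [i x|i j ij x|i j ij x].
  - by rewrite hA -lecR -!(sqnormE hH); apply: (contrT i).2.
  - rewrite !hA /p; case: ifPn => [/TT -> //|/(neqP _ _ ij) ji].
    by rewrite (TT _ _ ji) scalerA mulrC (unit _ _ ji) scale1r.
  - rewrite !hA !hA' /p; case: ifPn => [/TTs -> //|/(neqP _ _ ij) ji].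
    (* For j < i the hypothesis concerns [T j] and [Ts i]; taking adjoints turns it into the
       relation of [T i] and [Ts j]. *)
    rewrite conjCK; apply: inner_inj => y; rewrite (siZl hH).
    have Ts_adj l u v : inner (Ts l u) v = inner u (T l v).
      by rewrite inner_conjsym -adjT -inner_conjsym.
    by rewrite adjT !Ts_adj adjT (TTs _ _ ji) (siZr hH) conjCK.
have [W [t [B [B' [j [[ht adjB _ BB _] cB jlin [jiso jadj] dil]]]]]] :=
  unitary_dilation p_unit p_sym (enum 'I_k) qA.
have UK i : cancel (B i) (B' i) by apply: (cB i _).1; rewrite mem_enum.
have U'K i : cancel (B' i) (B i) by apply: (cB i _).2; rewrite mem_enum.
have adjB' i := adjoint_pairC ht (adjB i).
pose J x := inclusion ht (j x).
(* [Js] is the projection onto the image of [J], read in H. *)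
have [Js hJs] := choice (completion_coadjoint (hs := ht) jiso jadj).
pose U i := extend (hs := ht) (adjB i) (UK i).
pose Us i := extend (hs := ht) (adjB' i) (U'K i).
exists (completion_hilbert ht), J, Js, U, Us; split.
- split=> [a x y|x y]; first by rewrite /J jlin inclusion_linear.
  by rewrite -jiso; apply: inclusion_isometry.
- move=> x y; rewrite [RHS]inner_conjsym hJs.
  exact: (si_conj (completion_form_semi_inner ht)).
- move=> i; split; [exact: extend_linear|exact: extend_adjoint|..];
    exact: extend_cancel.
- move=> i i' ii' y; apply: extend_commute => x.
  by rewrite BB /p ?ii'// neq_ltn ii'.
- move=> m x; apply: inner_inj => z; rewrite hJs.
  (* The extensions act on included vectors as B and B' do, so the word is evaluated in W and
     included afterwards. *)
  have -> : oprod (fun i => zpow (U i) (Us i) (m i)) (J x)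
      = inclusion ht (word B B' m (enum 'I_k) (j x)).
    rewrite /oprod; elim: (enum _) => //= i r ->.
    by apply: zpow_intertwine => v; apply: extend_inclusion.
  rewrite inclusion_isometry dil ?enum_uniq//; congr (inner _ z).
  (* The bundled maps agree pointwise with [T] and [Ts], so the identity intertwines them. *)
  rewrite /oprod; elim: (enum _) => //= i r ->.
  by apply: (zpow_intertwine (j := id)) => v; rewrite ?hA ?hA'.
Qed.
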